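(* Let $\mathbb K$ be a field and $N\ge 2$ an integer. The category $\mathbf H_N\mathbf{Alg}$ of $N$-homogeneous algebras over $\mathbb K$ has the following properties. (i) $\mathbf H_N\mathbf{Alg}$ endowed with $\circ$ is a tensor category with unit object $\mathbb K[t]=A(\mathbb K t,0)$. (ii) $\mathbf H_N\mathbf{Alg}$ endowed with $\bullet$ is a tensor category with unit object $\wedge_N\{d\}=\mathbb K[t]^!$.
   Context: $\otimes$ is the tensor product over $\mathbb K$. An $N$-homogeneous algebra is an algebra of the form $\mathcal A=A(E,R)=T(E)/(R)$, where $E$ is a finite-dimensional $\mathbb K$-vector space, $R\subset E^{\otimes N}$ is a linear subspace, and $(R)$ is the two-sided ideal of the tensor algebra $T(E)$ generated by $R$. A morphism $f:A(E,R)\to A(E',R')$ is a linear map $f:E\to E'$ with $f^{\otimes N}(R)\subset R'$. These form the category $\mathbf H_N\mathbf{Alg}$; $\mathbf{Vect}$ denotes the category of finite-dimensional $\mathbb K$-vector spaces. The dual of $\mathcal A=A(E,R)$ is $\mathcal A^!=A(E^*,R^\perp)$, where $R^\perp\subset (E^{\otimes N})^*=E^{*\otimes N}$ is the annihilator of $R$. The dual $f^!$ of a morphism $f$ is the transposed linear map. For vector spaces $E,E'$ let $\pi_N:E^{\otimes N}\otimes E'^{\otimes N}\to (E\otimes E')^{\otimes N}$ be the linear isomorphism $e_1\otimes\cdots\otimes e_N\otimes e'_1\otimes\cdots\otimes e'_N\mapsto (e_1\otimes e'_1)\otimes\cdots\otimes(e_N\otimes e'_N)$. For $\mathcal A=A(E,R)$,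 $\mathcal A'=A(E',R')$ set $$\mathcal A\circ\mathcal A'=A\big(E\otimes E',\ \pi_N(R\otimes E'^{\otimes N}+E^{\otimes N}\otimes R')\big),\qquad \mathcal A\bullet\mathcal A'=A\big(E\otimes E',\ \pi_N(R\otimes R')\big).$$ On morphisms, both $f\circ g$ and $f\bullet g$ are given by the linear map $f\otimes g$. ''Tensor category'' is in the sense of Deligne–Milne, i.e. a symmetric monoidal category (associativity and commutativity constraints and a unit object, with the usual coherence); here the constraints are those induced by the canonical isomorphisms $E\otimes E'\simeq E'\otimes E$, $(E\otimes E')\otimes E''\simeq E\otimes(E'\otimes E'')$ and $\mathbb K\otimes E\simeq E\simeq E\otimes\mathbb K$ of $\mathbf{Vect}$. The algebra $\wedge_N\{d\}=\mathbb K[t]^!\simeq T(\mathbb K)/(\mathbb K^{\otimes N})$ is the unital graded algebra generated in degree one by $d$ with the relation $d^N=0$. *)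

(* Defs.v *)
From HB Require Import structures.
From mathcomp Require Import all_boot all_order all_algebra.

Set Implicit Arguments.
Unset Strict Implicit.
Unset Printing Implicit Defensive.

Import GRing.Theory.
Local Open Scope ring_scope.

Record category := Category {
  obj :> Type;
  hom : obj -> obj -> Type;
  idm : forall A, hom A A;
  compm : forall A B C, hom B C -> hom A B -> hom A C;
  compm1 : forall A B (f : hom A B), compm f (idm A) = f;
  comp1m : forall A B (f : hom A B), compm (idm B) f = f;
  compmA : forall A B C D (h : hom C D) (g : hom B C) (f : hom A B),
    compm h (compm g f) = compm (compm h g) f }.

Arguments hom {c} A B.
Arguments idm {c} A.
Arguments compm {c A B C} g f.

Notation "g 'oo' f" := (compm g f) (at level 40, left associativity).

Definition isom (C : category) (A B : C) (f : hom A B) : Prop :=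
  exists g : hom B A, g oo f = idm A /\ f oo g = idm B.

(* The structure of a tensor category (symmetric monoidal category) on C with
   prescribed tensor product on objects and prescribed unit object. *)
Record tensor_category (C : category) (tens : C -> C -> C) (one : C) :=
  TensorCategory {
  tens_hom : forall A A' B B' : C,
    hom A A' -> hom B B' -> hom (tens A B) (tens A' B');
  assoc : forall A B D : C, hom (tens (tens A B) D) (tens A (tens B D));
  swap : forall A B : C, hom (tens A B) (tens B A);
  lunit : forall A : C, hom (tens one A) A;
  runit : forall A : C, hom (tens A one) A;

  tens_hom1 : forall A B, tens_hom (idm A) (idm B) = idm (tens A B);
  tens_hom_comp : forall A A' A'' B B' B''
      (f' : hom A' A'') (f : hom A A') (g' : hom B' B'') (g : hom B B'),
    tens_hom (f' oo f) (g' oo g) = tens_hom f' g' oo tens_hom f g;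

  assoc_isom : forall A B D, isom (assoc A B D);
  swap_isom : forall A B, isom (swap A B);
  lunit_isom : forall A, isom (lunit A);
  runit_isom : forall A, isom (runit A);

  assoc_natural : forall A A' B B' D D'
      (f : hom A A') (g : hom B B') (h : hom D D'),
    assoc A' B' D' oo tens_hom (tens_hom f g) h
      = tens_hom f (tens_hom g h) oo assoc A B D;
  swap_natural : forall A A' B B' (f : hom A A') (g : hom B B'),
    swap A' B' oo tens_hom f g = tens_hom g f oo swap A B;
  lunit_natural : forall A A' (f : hom A A'),
    lunit A' oo tens_hom (idm one) f = f oo lunit A;
  runit_natural : forall A A' (f : hom A A'),
    runit A' oo tens_hom f (idm one) = f oo runit A;

  pentagon : forall A B D E,
    assoc A B (tens D E) oo assoc (tens A B) D E
      = tens_hom (idm A) (assoc B D E) oo assoc A (tens B D) E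
          oo tens_hom (assoc A B D) (idm E);
  triangle : forall A B,
    tens_hom (idm A) (lunit B) oo assoc A one B
      = tens_hom (runit A) (idm B);
  hexagon : forall A B D,
    assoc B D A oo swap A (tens B D) oo assoc A B D
      = tens_hom (idm B) (swap A D) oo assoc B A D
          oo tens_hom (swap A B) (idm D);
  swapK : forall A B, swap B A oo swap A B = idm (tens A B) }.

Section Tensor.
Variable K : fieldType.
Implicit Types E F V W : vectType K.

Definition dual E : vectType K := 'Hom(E, K^o).

(* The tensor product is modelled by matrices of coordinates on the bases
   vbasis fullv; only the universal property (tlift_pure and tens_ext) is
   meant to be used. *)
Definition tens E F : vectType K := 'M[K]_(\dim {:E}, \dim {:F}).

Definition pure E F (a : E) (b : F) : tens E F :=
  \matrix_(i, j) (coord (vbasis {:E}) i a * coord (vbasis {:F}) j b).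

(* For a bilinear B, the linear map sending pure a b to B a b. *)
Definition tlift E F V (B : E -> F -> V) : 'Hom(tens E F, V) :=
  linfun (fun u : tens E F =>
    \sum_i \sum_j (u : 'M_(_, _)) i j *: B (vbasis {:E})`_i (vbasis {:F})`_j).

Lemma lfun_linE V W (f : V -> W) : linear f -> linfun f =1 f.
Proof.
move=> fP.
exact: (lfunE (HB.pack_for {linear V -> W} f
                 (GRing.isLinear.Build _ _ _ _ f fP))).
Qed.

Lemma pure_linearl E F (b : F) : linear (fun a : E => pure a b).
Proof.
move=> k a a'; apply/matrixP=> i j; rewrite !mxE linearP /=.
by rewrite mulrDl mulrA.
Qed.

Lemma pure_linearr E F (a : E) : linear (fun b : F => pure a b).
Proof.
move=> k b b'; apply/matrixP=> i j; rewrite !mxE linearP /=.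
by rewrite mulrDr mulrCA.
Qed.

Lemma pure_basis E F (i : 'I_(\dim {:E})) (j : 'I_(\dim {:F})) :
  pure (vbasis {:E})`_i (vbasis {:F})`_j = delta_mx i j :> 'M_(_, _).
Proof.
rewrite /pure; apply/matrixP=> i' j'; rewrite !mxE.
have freeE := basis_free (vbasisP {:E}).
have freeF := basis_free (vbasisP {:F}).
rewrite (coord_free _ _ freeE) (coord_free _ _ freeF) -natrM mulnb.
by rewrite (eq_sym i) (eq_sym j).
Qed.

Lemma tliftE E F V (B : E -> F -> V) u : tlift B u =
  \sum_i \sum_j (u : 'M_(_, _)) i j *: B (vbasis {:E})`_i (vbasis {:F})`_j.
Proof.
rewrite lfun_linE // => k v w; rewrite scaler_sumr -big_split.
apply: eq_bigr => i _ /=; rewrite scaler_sumr -big_split.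
by apply: eq_bigr => j _; rewrite /= !mxE scalerDl scalerA.
Qed.

Lemma tlift_pure E F V (B : E -> F -> V) :
  (forall a, linear (B a)) -> (forall b, linear (B^~ b)) ->
  forall a b, tlift B (pure a b) = B a b.
Proof.
move=> Br Bl a b; rewrite tliftE.
rewrite -[RHS](lfun_linE (Bl b) a) {2}(coord_vbasis (memvf a)) linear_sum.
apply: eq_bigr => i _; rewrite linearZ /= lfun_linE //.
rewrite -[in RHS](lfun_linE (Br _) b) {2}(coord_vbasis (memvf b)) linear_sum.
rewrite scaler_sumr; apply: eq_bigr => j _.
by rewrite linearZ /= lfun_linE // scalerA mxE.
Qed.

Lemma tens_ext E F V (f g : 'Hom(tens E F, V)) :
  (forall a b, f (pure a b) = g (pure a b)) -> f = g.
Proof.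
move=> fg; apply/lfunP=> u; rewrite (matrix_sum_delta (u : 'M_(_, _))).
rewrite !linear_sum; apply: eq_bigr => i _; rewrite !linear_sum.
by apply: eq_bigr => j _; rewrite !linearZ /= -pure_basis fg.
Qed.

Definition tmap E E' F F' (f : 'Hom(E, E')) (g : 'Hom(F, F')) :
  'Hom(tens E F, tens E' F') := tlift (fun a b => pure (f a) (g b)).

Lemma tmap_pure E E' F F' (f : 'Hom(E, E')) (g : 'Hom(F, F')) a b :
  tmap f g (pure a b) = pure (f a) (g b).
Proof.
rewrite tlift_pure // => c k x y.
  by rewrite linearP /= pure_linearr.
by rewrite linearP /= pure_linearl.
Qed.

(* E^{(x) n.+1} is E (x) E^{(x) n}, and E^{(x) 0} is K. *)
Fixpoint tpow E n : vectType K :=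
  if n is n'.+1 then tens E (tpow E n') else K^o.

Fixpoint tpure E n : ('I_n -> E) -> tpow E n :=
  match n with
  | 0 => fun=> 1
  | n'.+1 => fun e => pure (e ord0) (tpure (fun i => e (lift ord0 i)))
  end.

Fixpoint tpow_map E F (f : 'Hom(E, F)) n : 'Hom(tpow E n, tpow F n) :=
  if n is n'.+1 then tmap f (tpow_map f n') else \1%VF.

Definition interchange E E' F F' :
    'Hom(tens (tens E E') (tens F F'), tens (tens E F) (tens E' F')) :=
  tlift (fun x y =>
    tlift (fun a a' => tlift (fun b b' => pure (pure a b) (pure a' b')) y) x).

Fixpoint tpi E F n : 'Hom(tens (tpow E n) (tpow F n), tpow (tens E F) n) :=
  match n with
  | 0 => tlift (fun k l : K^o => k * l : K^o)
  | n'.+1 => (tmap \1 (tpi E F n') \o interchange E (tpow E n') F (tpow F n'))%VF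
  end.

(* The identification of (E^* )^{(x) n} with (E^{(x) n})^*. *)
Fixpoint tpow_dual E n : 'Hom(tpow (dual E) n, dual (tpow E n)) :=
  match n with
  | 0 => linfun (fun k : K^o => k *: \1%VF : dual K^o)
  | n'.+1 => tlift (fun (phi : dual E) w =>
      tlift (fun a u => phi a * (tpow_dual E n' w : 'Hom(_, _)) u : K^o))
  end.

Lemma interchange_pure E E' F F' (a : E) (a' : E') (b : F) (b' : F') :
  interchange E E' F F' (pure (pure a a') (pure b b'))
    = pure (pure a b) (pure a' b').
Proof.
have L (c : E) (c' : E') (y : tens F F') :
    tlift (fun b b' => pure (pure c b) (pure c' b')) y
      = tmap (linfun (fun b => pure c b : tens E F))
             (linfun (fun b' => pure c' b' : tens E' F')) y.
  congr (fun_of_lfun _ _); apply: tens_ext => d d'; rewrite tmap_pure.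
  rewrite !(lfun_linE (pure_linearr _)) tlift_pure // => e k x z.
    by rewrite !pure_linearr.
  by rewrite pure_linearr pure_linearl.
rewrite tlift_pure.
- rewrite tlift_pure => [|c k x z|c k x z].
  + by rewrite L tmap_pure !(lfun_linE (pure_linearr _)).
  + rewrite !L -scale_lfunE -add_lfunE; congr (fun_of_lfun _ _).
    apply: tens_ext => d d'; rewrite add_lfunE scale_lfunE !tmap_pure.
    by rewrite !(lfun_linE (pure_linearr _)) pure_linearl pure_linearr.
  rewrite !L -scale_lfunE -add_lfunE; congr (fun_of_lfun _ _).
  apply: tens_ext => d d'; rewrite add_lfunE scale_lfunE !tmap_pure.
  by rewrite !(lfun_linE (pure_linearr _)) !pure_linearl.
- move=> x k y z; rewrite !tliftE scaler_sumr -big_split; apply: eq_bigr => i _.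
  rewrite scaler_sumr -big_split; apply: eq_bigr => j _ /=.
  by rewrite linearP scalerDr !scalerA mulrC.
move=> y k x z; exact: linearP.
Qed.

Lemma tpow_map_pure E F (f : 'Hom(E, F)) n (e : 'I_n -> E) :
  tpow_map f n (tpure e) = tpure (fun i => f (e i)).
Proof.
elim: n e => [|n IHn] e /=; first by rewrite id_lfunE.
by rewrite tmap_pure IHn.
Qed.

Lemma tpi_pure E F n (e : 'I_n -> E) (e' : 'I_n -> F) :
  tpi E F n (pure (tpure e) (tpure e')) = tpure (fun i => pure (e i) (e' i)).
Proof.
elim: n e e' => [|n IHn] e e' /=.
  rewrite tlift_pure ?mulr1 // => a k x y; last by rewrite mulrDl scalerAl.
  by rewrite mulrDr scalerAr.
by rewrite comp_lfunE interchange_pure tmap_pure id_lfunE IHn.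
Qed.

Lemma tpow_dual_pure E n (phi : 'I_n -> dual E) (e : 'I_n -> E) :
  (tpow_dual E n (tpure phi) : 'Hom(_, _)) (tpure e)
    = \prod_i (phi i : 'Hom(_, _)) (e i).
Proof.
elim: n phi e => [|n IHn] phi e /=.
  rewrite big_ord0 lfun_linE => [|k x y]; first by rewrite scale1r id_lfunE.
  by rewrite scalerDl scalerA.
have L (f : dual E) w : tlift (fun a u =>
    (f : 'Hom(_, _)) a * (tpow_dual E n w : 'Hom(_, _)) u : K^o)
    = (tlift (fun k l : K^o => k * l : K^o)
         \o tmap (f : 'Hom(_, _)) (tpow_dual E n w : 'Hom(_, _)))%VF.
  apply: tens_ext => a u; rewrite comp_lfunE tmap_pure !tlift_pure //.
  - by move=> k c x y; rewrite mulrDr scalerAr.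
  - by move=> k c x y; rewrite mulrDl scalerAl.
  - by move=> c k x y; rewrite linearP /= mulrDr scalerAr.
  by move=> c k x y; rewrite linearP /= mulrDl scalerAl.
have mE (k l : K^o) : tlift (fun k l : K^o => k * l : K^o) (pure k l) = k * l.
  rewrite tlift_pure => // c d x y.
    by rewrite mulrDr scalerAr.
  by rewrite mulrDl scalerAl.
rewrite tlift_pure => [|f k x y|w k x y].
- by rewrite L comp_lfunE tmap_pure mE IHn big_ord_recl.
- apply: tens_ext => a u; rewrite add_lfunE scale_lfunE !L !comp_lfunE.
  rewrite !tmap_pure !mE linearP /= add_lfunE scale_lfunE mulrDr.
  by congr (_ + _); rewrite -scalerAr.
apply: tens_ext => a u; rewrite add_lfunE scale_lfunE !L !comp_lfunE.
rewrite !tmap_pure !mE add_lfunE scale_lfunE mulrDl.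
by congr (_ + _); rewrite -scalerAl.
Qed.

Lemma tpow_map1 E n : tpow_map (\1 : 'Hom(E, E))%VF n = \1%VF.
Proof.
elim: n => //= n ->; apply: tens_ext => a b.
by rewrite tmap_pure !id_lfunE.
Qed.

Lemma tpow_map_comp E F V (g : 'Hom(F, V)) (f : 'Hom(E, F)) n :
  tpow_map (g \o f)%VF n = (tpow_map g n \o tpow_map f n)%VF.
Proof.
elim: n => [|n IHn] /=; first by rewrite comp_lfun1l.
by apply: tens_ext => a b; rewrite comp_lfunE !tmap_pure IHn !comp_lfunE.
Qed.

(* phi vanishes on U if and only if its composite with a projection onto U is
   zero, see memv_annihilator. *)
Definition annihilator V (U : {vspace V}) : {vspace dual V} :=
  lker (linfun (fun phi : dual V => (phi \o projv U)%VF : dual V)).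

Lemma memv_annihilator V (U : {vspace V}) (phi : 'Hom(V, K^o)) :
  reflect {in U, forall u, phi u = 0} (phi \in annihilator U).
Proof.
rewrite memv_ker lfun_linE => [|k f g]; last first.
  by rewrite comp_lfunDl comp_lfunZl.
apply: (iffP eqP) => [phi0 u uU | phi0].
  have /lfunP/(_ u) := phi0; rewrite comp_lfunE projv_id // => ->.
  by rewrite zero_lfunE.
by apply/lfunP=> v; rewrite comp_lfunE zero_lfunE phi0 // memv_proj.
Qed.

Definition tensv V W (U : {vspace V}) (U' : {vspace W}) : {vspace tens V W} :=
  <<[seq pure a b | a <- vbasis U, b <- vbasis U']>>%VS.

Lemma memv_tensv V W (U : {vspace V}) (U' : {vspace W}) a b :
  a \in U -> b \in U' -> pure a b \in tensv U U'.
Proof.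
move=> /coord_vbasis-> /coord_vbasis->.
rewrite -(lfun_linE (pure_linearl _)) linear_sum rpred_sum // => i _.
rewrite linearZ rpredZ //= lfun_linE; last exact: pure_linearl.
rewrite -(lfun_linE (pure_linearr _)) linear_sum rpred_sum // => j _.
rewrite linearZ rpredZ //= lfun_linE; last exact: pure_linearr.
by apply: memv_span; apply: allpairs_f; rewrite mem_nth ?size_tuple.
Qed.

End Tensor.

Arguments tmap {K E E' F F'} f g.
Arguments tpow {K} E n.

(* A(E, R) is represented by the pair (E, R). For N >= 2 nothing is lost: E is
   the degree one component of T(E)/(R) and R is the kernel of the product map
   from E^{(x) N} to its degree N component. *)
Record hnalg (K : fieldType) (N : nat) := HNAlg {
  gens : vectType K;
  rels : {vspace tpow gens N} }.

Record hnhom (K : fieldType) (N : nat) (A B : hnalg K N) := HNHom {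
  hnlin :> 'Hom(gens A, gens B);
  hnhomP : (tpow_map hnlin N @: rels A <= rels B)%VS }.

Section HNAlgCategory.
Variables (K : fieldType) (N : nat).
Implicit Types A B C D : hnalg K N.

Lemma hnhom_inj A B (f g : hnhom A B) : hnlin f = hnlin g -> f = g.
Proof.
case: f g => [f fP] [g gP] /= eq_fg; case: _ / eq_fg gP => gP.
by rewrite (bool_irrelevance fP gP).
Qed.

Fact hnid_proof A : (tpow_map (\1 : 'End(gens A)) N @: rels A <= rels A)%VS.
Proof. by rewrite tpow_map1 lim1g subvv. Qed.

Definition hnid A : hnhom A A := HNHom (hnid_proof A).

Fact hncomp_proof A B C (g : hnhom B C) (f : hnhom A B) :
  (tpow_map (g \o f)%VF N @: rels A <= rels C)%VS.
Proof.
rewrite tpow_map_comp limg_comp.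
exact: subv_trans (limgS _ (hnhomP f)) (hnhomP g).
Qed.

Definition hncomp A B C (g : hnhom B C) (f : hnhom A B) : hnhom A C :=
  HNHom (hncomp_proof g f).

Fact hncompm1 A B (f : hnhom A B) : hncomp f (hnid A) = f.
Proof. by apply: hnhom_inj; rewrite /= comp_lfun1r. Qed.

Fact hncomp1m A B (f : hnhom A B) : hncomp (hnid B) f = f.
Proof. by apply: hnhom_inj; rewrite /= comp_lfun1l. Qed.

Fact hncompA A B C D (h : hnhom C D) (g : hnhom B C) (f : hnhom A B) :
  hncomp h (hncomp g f) = hncomp (hncomp h g) f.
Proof. by apply: hnhom_inj; rewrite /= comp_lfunA. Qed.

Definition HN_Alg : category := Category hncompm1 hncomp1m hncompA.

Definition hndual A : hnalg K N :=
  @HNAlg K N (dual (gens A))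
    (tpow_dual (gens A) N @^-1: annihilator (rels A))%VS.

Definition hncirc A B : hnalg K N :=
  @HNAlg K N (tens (gens A) (gens B))
    (tpi (gens A) (gens B) N
       @: (tensv (rels A) fullv + tensv fullv (rels B)))%VS.

Definition hnbullet A B : hnalg K N :=
  @HNAlg K N (tens (gens A) (gens B))
    (tpi (gens A) (gens B) N @: tensv (rels A) (rels B))%VS.

(* K[t], with t = 1 in K. *)
Definition hnpoly : hnalg K N := @HNAlg K N K^o 0%VS.

(* Generated by d = id in the dual of K; its space of relations is the whole of
   (K^* )^{(x) N}, that is, d^N = 0. *)
Definition hnwedge : hnalg K N := hndual hnpoly.

End HNAlgCategory.

(* Main.v *)
Require Import Defs.
From mathcomp Require Import all_boot all_order all_algebra.

Set Implicit Arguments.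
Unset Strict Implicit.
Unset Printing Implicit Defensive.

Import GRing.Theory.
Local Open Scope ring_scope.

(* The constraints of HN_Alg are those of Vect, so equalities of morphisms are
   checked on pure tensors and only the compatibility with the relations is at
   stake. Both products have relations tpi (T(R, R')) for an operation T on
   subspaces, T(R, R') = R (x) R' for the bullet product and
   T(R, R') = R (x) E' + E (x) R' for the circle product. Since tpi is invertible
   and commutes with the constraints, it suffices that T be natural, associative
   and symmetric. The unit (I, R_I), with I of dimension one, works as soon as
   T(J, U) is identified with U for the image J of R_I in K: J = 0 for the circle
   product, J = K for the bullet product. *)

(** * Linear maps determined by their values on pure tensors *)

Section Separating.
Variable K : fieldType.
Implicit Types E F G V W : vectType K.

Lemma pureZl E F k (a : E) (b : F) : pure (k *: a) b = k *: pure a b.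
Proof. by apply/matrixP=> i j; rewrite !mxE linearZ mulrA. Qed.

Lemma pureZr E F k (a : E) (b : F) : pure a (k *: b) = k *: pure a b.
Proof. by apply/matrixP=> i j; rewrite !mxE linearZ mulrCA. Qed.

(** Equivalent to the range of [p] spanning [V]. The form with maps passes to iterated tensor
    products and proves equalities of morphisms directly. *)
Definition separating (X : Type) V (p : X -> V) : Prop :=
  forall W (f g : 'Hom(V, W)), (forall x, f (p x) = g (p x)) -> f = g.

Lemma separating_id V : separating (@id V).
Proof. by move=> W f g fg; apply/lfunP. Qed.

(** One factor at a time: with the other factor fixed, both sides are linear maps of a single
    variable. *)
Lemma separating_pure X Y E F (p : X -> E) (q : Y -> F) :
  separating p -> separating q ->
  separating (fun xy : X * Y => pure (p xy.1) (q xy.2)).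
Proof.
move=> sp sq W f g fg; apply: tens_ext => a b.
have pl (c : F) (d : E) : linfun (fun a => pure a c) d = pure d c :> tens E F.
  by rewrite lfun_linE //; apply: pure_linearl.
have pr (c : E) (d : F) : linfun (fun b => pure c b) d = pure c d :> tens E F.
  by rewrite lfun_linE //; apply: pure_linearr.
rewrite -pl -!comp_lfunE; congr (fun_of_lfun _ _); apply: sp => x.
rewrite !comp_lfunE !pl -pr -!comp_lfunE; congr (fun_of_lfun _ _).
by apply: sq => y; rewrite !comp_lfunE !pr; apply: (fg (x, y)).
Qed.

Lemma eq_tpure E n (e e' : 'I_n -> E) : e =1 e' -> tpure e = tpure e'.
Proof.
elim: n e e' => //= n IHn e e' ee'; rewrite ee'; congr pure.
by apply: IHn => i; apply: ee'.
Qed.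

Lemma separating_tpure X E n (p : X -> E) :
  separating p -> separating (fun e : 'I_n -> X => tpure (fun i => p (e i))).
Proof.
move=> sp; elim: n => [|n IHn] W f g fg.
  (* In degree 0 only the empty tuple is available; its [tpure] is 1, which spans K. As [X] may be
     empty, the tuple is built by eliminating ['I_0]. *)
  apply/lfunP => k; have fg1 := fg (fun i : 'I_0 => match i with Ordinal _ h =>
    False_rect X (notF h) end).
  by rewrite -[k]mulr1 -[k * 1]/(k *: (1 : K^o)) !linearZ /= fg1.
apply: (separating_pure sp IHn) => -[x e] /=.
(* The tuple with head [x] and tail [e]: [unlift ord0] fails exactly at [ord0], where the default
   [x] is taken. *)
have := fg (fun i => oapp e x (unlift ord0 i)); rewrite /= unlift_none /=.
by congr (f (pure _ _) = g (pure _ _)); apply: eq_tpure => i; rewrite liftK.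
Qed.

(** Collects the coordinates of the factors into one scalar; this is how the unit constraint in
    degree N reduces to a multiplication by scalars. *)
Lemma tpureZ E n (k : 'I_n -> K) (e : 'I_n -> E) :
  tpure (fun i => k i *: e i) = (\prod_i k i) *: tpure e.
Proof.
elim: n k e => [|n IHn] k e /=; first by rewrite big_ord0 scale1r.
by rewrite IHn big_ord_recl -scalerA pureZl pureZr.
Qed.

(** * Functoriality and constraints of the tensor product of spaces *)

Lemma tmap1 E F : tmap (\1 : 'End(E)) (\1 : 'End(F)) = \1%VF.
Proof. by apply: tens_ext => a b; rewrite tmap_pure !id_lfunE. Qed.

Lemma tmap_comp E E' E'' F F' F'' (f' : 'Hom(E', E'')) (f : 'Hom(E, E'))
    (g' : 'Hom(F', F'')) (g : 'Hom(F, F')) :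
  tmap (f' \o f)%VF (g' \o g)%VF = (tmap f' g' \o tmap f g)%VF.
Proof. by apply: tens_ext => a b; rewrite comp_lfunE !tmap_pure !comp_lfunE. Qed.

Lemma tens_ext3 E F G V (f g : 'Hom(tens (tens E F) G, V)) :
  (forall a b c, f (pure (pure a b) c) = g (pure (pure a b) c)) -> f = g.
Proof.
move=> fg; apply: (separating_pure (separating_pure (@separating_id E)
  (@separating_id F)) (@separating_id G)) => -[[a b] c]; exact: fg.
Qed.

Lemma tens_ext3r E F G V (f g : 'Hom(tens E (tens F G), V)) :
  (forall a b c, f (pure a (pure b c)) = g (pure a (pure b c))) -> f = g.
Proof.
move=> fg; apply: (separating_pure (@separating_id E) (separating_pure
  (@separating_id F) (@separating_id G))) => -[a [b c]]; exact: fg.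
Qed.

Lemma tens_ext4 E F G H V (f g : 'Hom(tens (tens (tens E F) G) H, V)) :
  (forall a b c d, f (pure (pure (pure a b) c) d)
                     = g (pure (pure (pure a b) c) d)) -> f = g.
Proof.
move=> fg; apply: (separating_pure (separating_pure (separating_pure
  (@separating_id E) (@separating_id F)) (@separating_id G))
  (@separating_id H)) => -[[[a b] c] d]; exact: fg.
Qed.

(** [tlift] takes a bilinear map, and [u] is an arbitrary tensor: for fixed [c] the map is the
    identity tensored with the map sending [b] to [pure b c]. *)
Definition tassoc E F G : 'Hom(tens (tens E F) G, tens E (tens F G)) :=
  tlift (fun u c => tmap \1%VF (linfun (fun b => pure b c : tens F G)) u).

Definition tswap E F : 'Hom(tens E F, tens F E) := tlift (fun a b => pure b a).

Definition tscale V : 'Hom(tens K^o V, V) :=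
  tlift (fun (k : K^o) a => (k : K) *: a).

Lemma tassoc_pure E F G (a : E) (b : F) (c : G) :
  tassoc E F G (pure (pure a b) c) = pure a (pure b c).
Proof.
rewrite tlift_pure ?tmap_pure ?id_lfunE ?lfun_linE //.
- exact: pure_linearl.
- move=> u k x y; rewrite -scale_lfunE -add_lfunE; congr (fun_of_lfun _ _).
  apply: tens_ext => a' b'; rewrite add_lfunE scale_lfunE !tmap_pure !id_lfunE.
  rewrite !lfun_linE; try exact: pure_linearl.
  by rewrite !pure_linearr.
- by move=> c' k x y; rewrite linearP.
Qed.

Lemma tswap_pure E F (a : E) (b : F) : tswap E F (pure a b) = pure b a.
Proof.
by rewrite tlift_pure // => c k x y; rewrite ?pure_linearl ?pure_linearr.
Qed.

Lemma tscale_pure V (k : K^o) (a : V) : tscale V (pure k a) = (k : K) *: a.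
Proof.
rewrite tlift_pure // => c l x y; first by rewrite scalerDr !scalerA mulrC.
by rewrite scalerDl scalerA.
Qed.

(** The inverse of [tpi]: its steps are undone in reverse order, the inverse of an interchange being
    the interchange with the two middle spaces swapped. *)
Fixpoint tpiV E F n : 'Hom(tpow (tens E F) n, tens (tpow E n) (tpow F n)) :=
  match n return 'Hom(tpow (tens E F) n, tens (tpow E n) (tpow F n)) with
  | 0 => linfun (fun k : K^o => pure k (1 : K^o) : tens K^o K^o)
  | n'.+1 => (Defs.interchange E F (tpow E n') (tpow F n')
                \o tmap \1 (tpiV E F n'))%VF
  end.

Lemma tpiV_pure E F n (e : 'I_n -> E) (e' : 'I_n -> F) :
  tpiV E F n (tpure (fun i => pure (e i) (e' i))) = pure (tpure e) (tpure e').
Proof.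
elim: n e e' => [|n IHn] e e' /=; first by rewrite (lfun_linE (pure_linearl _)).
by rewrite comp_lfunE tmap_pure id_lfunE IHn interchange_pure.
Qed.

Lemma tpiK E F n : (tpiV E F n \o tpi E F n = \1)%VF.
Proof.
apply: (separating_pure (separating_tpure (@separating_id E))
                        (separating_tpure (@separating_id F))) => -[e e'] /=.
by rewrite comp_lfunE tpi_pure tpiV_pure id_lfunE.
Qed.

Lemma tpiVK E F n : (tpi E F n \o tpiV E F n = \1)%VF.
Proof.
apply: (separating_tpure (separating_pure (@separating_id E)
                                          (@separating_id F))) => e /=.
by rewrite comp_lfunE tpiV_pure tpi_pure id_lfunE.
Qed.

(** Together with [tpi_assoc] and [tpi_swap], moves N-th tensor powers across [tpi], so that
    compatibility with the relations becomes a statement on subspaces in which N does not occur. *)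
Lemma tpi_natural E E' F F' (f : 'Hom(E, E')) (g : 'Hom(F, F')) n :
  (tpow_map (tmap f g) n \o tpi E F n
     = tpi E' F' n \o tmap (tpow_map f n) (tpow_map g n))%VF.
Proof.
apply: (separating_pure (separating_tpure (@separating_id E))
                        (separating_tpure (@separating_id F))) => -[e e'] /=.
rewrite !comp_lfunE tmap_pure !tpow_map_pure !tpi_pure tpow_map_pure.
by apply: eq_tpure => i; rewrite tmap_pure.
Qed.

Lemma tpi_assoc E F G n :
  (tpow_map (tassoc E F G) n \o (tpi (tens E F) G n \o tmap (tpi E F n) \1)
     = tpi E (tens F G) n \o (tmap \1 (tpi F G n) \o tassoc _ _ _))%VF.
Proof.
apply: (separating_pure (separating_pure (separating_tpure (@separating_id E))
  (separating_tpure (@separating_id F))) (separating_tpure (@separating_id G))).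
move=> -[[a b] c] /=; rewrite !comp_lfunE tassoc_pure !tmap_pure !id_lfunE.
rewrite !tpi_pure tpow_map_pure; apply: eq_tpure => i; exact: tassoc_pure.
Qed.

Lemma tpi_swap E F n :
  (tpow_map (tswap E F) n \o tpi E F n = tpi F E n \o tswap _ _)%VF.
Proof.
apply: (separating_pure (separating_tpure (@separating_id E))
                        (separating_tpure (@separating_id F))) => -[e e'] /=.
rewrite !comp_lfunE tswap_pure !tpi_pure tpow_map_pure.
by apply: eq_tpure => i; apply: tswap_pure.
Qed.

End Separating.

(** * Operations on subspaces of a tensor product *)

Section Tensv.
Variable K : fieldType.
Implicit Types V W : vectType K.

Lemma tensv_subP V W (U : {vspace V}) (U' : {vspace W}) (S : {vspace tens V W}) :
  (forall a b, a \in U -> b \in U' -> pure a b \in S) -> (tensv U U' <= S)%VS.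
Proof.
move=> sub; apply/span_subvP => _ /allpairsP[[a b] /= [aU bU' ->]].
by apply: sub; apply: vbasis_mem.
Qed.

Lemma tensv_fullv V W : tensv fullv fullv = fullv :> {vspace tens V W}.
Proof.
apply/eqP; rewrite eqEsubv subvf; apply/subvP => u _.
rewrite (matrix_sum_delta (u : 'M_(_, _))).
apply: rpred_sum => i _; apply: rpred_sum => j _; apply: rpredZ.
by rewrite -pure_basis memv_tensv ?memvf.
Qed.

(** This is the kernel of the projection of V (x) W onto (V/U) (x) (W/U'). *)
Definition tensv_add V W (U : {vspace V}) (U' : {vspace W}) :
  {vspace tens V W} := (tensv U fullv + tensv fullv U')%VS.

End Tensv.

(** Inclusions are enough: along isomorphisms [trelS] yields an equality ([trel_limg]), and the
    inverse of the associator is composed from the associator and swaps. *)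
Record tensor_rel (K : fieldType) := TensorRel {
  trel : forall V W : vectType K,
    {vspace V} -> {vspace W} -> {vspace tens V W};
  trelS : forall (V V' W W' : vectType K) (f : 'Hom(V, V')) (g : 'Hom(W, W'))
      (U : {vspace V}) (U1 : {vspace V'}) (U' : {vspace W}) (U1' : {vspace W'}),
    (f @: U <= U1)%VS -> (g @: U' <= U1')%VS ->
    (tmap f g @: trel U U' <= trel U1 U1')%VS;
  trelA : forall (V V' V'' : vectType K)
      (U : {vspace V}) (U' : {vspace V'}) (U'' : {vspace V''}),
    (tassoc V V' V'' @: trel (trel U U') U'' <= trel U (trel U' U''))%VS;
  trelC : forall (V W : vectType K) (U : {vspace V}) (U' : {vspace W}),
    (tswap V W @: trel U U' <= trel U' U)%VS }.

(** * The tensor category attached to an operation on subspaces *)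

Section TensorRel.
Variables (K : fieldType) (N : nat) (T : tensor_rel K).
Implicit Types (V W : vectType K) (A B C D : hnalg K N).

Lemma limgK V W (f : 'Hom(V, W)) (f' : 'Hom(W, V)) U :
  (f' \o f = \1)%VF -> (f' @: (f @: U) = U)%VS.
Proof. by move=> fK; rewrite -limg_comp fK lim1g. Qed.

(** One inclusion is [trelS] for [f] and [g], the other is [trelS] for their inverses. *)
Lemma trel_limg V V' W W' (f : 'Hom(V, V')) (f' : 'Hom(V', V))
    (g : 'Hom(W, W')) (g' : 'Hom(W', W)) U U' :
  (f' \o f = \1)%VF -> (f \o f' = \1)%VF ->
  (g' \o g = \1)%VF -> (g \o g' = \1)%VF ->
  (trel T (f @: U) (g @: U') = tmap f g @: trel T U U')%VS.
Proof.
move=> fK f'K gK g'K; apply/eqP; rewrite eqEsubv trelS // andbT.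
rewrite -[X in (X <= _)%VS](@limgK _ _ (tmap f' g') (tmap f g)); last first.
  by rewrite -tmap_comp f'K g'K tmap1.
by apply: limgS; apply: trelS; rewrite limgK.
Qed.

(** Convertible to [hncirc] for [tensv_add_rel] and to [hnbullet] for [tensv_rel]; this is why those
    instances are transparent. *)
Definition hntens A B : hnalg K N :=
  @HNAlg K N (tens (gens A) (gens B))
    (tpi (gens A) (gens B) N @: trel T (rels A) (rels B))%VS.

Fact hntmap_proof A A' B B' (f : hnhom A A') (g : hnhom B B') :
  (tpow_map (tmap f g) N @: rels (hntens A B) <= rels (hntens A' B'))%VS.
Proof.
rewrite -limg_comp tpi_natural limg_comp limgS //.
by apply: trelS; apply: hnhomP.
Qed.

Definition hntmap A A' B B' (f : hnhom A A') (g : hnhom B B') :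
  hnhom (hntens A B) (hntens A' B') :=
  @HNHom K N (hntens _ _) (hntens _ _) _ (hntmap_proof f g).

Fact hnassoc_proof A B C :
  (tpow_map (tassoc (gens A) (gens B) (gens C)) N
     @: rels (hntens (hntens A B) C) <= rels (hntens A (hntens B C)))%VS.
Proof.
(* The relations of [C] become an image under the identity, so that [trel_limg] can pull the inner
   [tpi] out of [trel]. *)
rewrite /= -[X in trel T _ X]lim1g.
rewrite (trel_limg _ _ (tpiK _ _ _) (tpiVK _ _ _)
           (comp_lfun1l \1) (comp_lfun1l \1)).
rewrite -!limg_comp -comp_lfunA tpi_assoc !limg_comp limgS //.
apply: subv_trans (limgS _ (trelA _ _ _ _)) _.
by apply: trelS; rewrite ?lim1g.
Qed.

Definition hnassoc A B C :
  hnhom (hntens (hntens A B) C) (hntens A (hntens B C)) :=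
  @HNHom K N (hntens (hntens _ _) _) (hntens _ (hntens _ _)) _
    (hnassoc_proof A B C).

Fact hnswap_proof A B :
  (tpow_map (tswap (gens A) (gens B)) N
     @: rels (hntens A B) <= rels (hntens B A))%VS.
Proof. by rewrite -limg_comp tpi_swap limg_comp limgS // trelC. Qed.

Definition hnswap A B : hnhom (hntens A B) (hntens B A) :=
  @HNHom K N (hntens _ _) (hntens _ _) _ (hnswap_proof A B).

Lemma hnswapK A B : hncomp (hnswap B A) (hnswap A B) = hnid _.
Proof.
apply: hnhom_inj; apply: tens_ext => a b /=.
by rewrite comp_lfunE !tswap_pure id_lfunE.
Qed.

(* The generators of the unit object form a line spanned by u, with coordinate
   eps. *)
Variables (one : hnalg K N) (eps : 'Hom(gens one, K^o)) (u : gens one).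
Hypotheses (eps_u : eps u = 1) (epsK : forall x, (eps x : K) *: u = x).

(** The N-th tensor power of [eps], with values in K. Its inverse is [tepsV]: the N-th tensor power
    of a line is again a line. *)
Definition teps : 'Hom(tpow (gens one) N, K^o) :=
  tpow_dual (gens one) N (tpure (fun=> eps : dual (gens one))).

Definition tepsV : 'Hom(K^o, tpow (gens one) N) :=
  linfun (fun k : K^o => (k : K) *: tpure (fun _ : 'I_N => u)).

Lemma tepsVE (k : K^o) : tepsV k = (k : K) *: tpure (fun=> u).
Proof. by rewrite lfun_linE // => c x y; rewrite scalerDl scalerA. Qed.

Lemma teps_pure e : teps (tpure e) = \prod_i eps (e i).
Proof. exact: tpow_dual_pure. Qed.

Lemma tepsK : (tepsV \o teps = \1)%VF.
Proof.
apply: (separating_tpure (@separating_id _ (gens one))) => e /=.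
rewrite comp_lfunE tepsVE teps_pure -tpureZ id_lfunE.
by apply: eq_tpure => i; apply: epsK.
Qed.

Lemma tepsVK : (teps \o tepsV = \1)%VF.
Proof.
apply/lfunP => k; rewrite comp_lfunE tepsVE linearZ /= teps_pure id_lfunE.
by rewrite big1 // -[_ *: _]/(k * 1) mulr1.
Qed.

(** An equality, because the inverse of the unit constraint must preserve the relations as well. *)
Hypothesis trel1 : forall V (U : {vspace V}),
  (tscale V @: trel T (teps @: rels one) U = U)%VS.

(** * Unit constraints *)

Definition tlunit V : 'Hom(tens (gens one) V, V) :=
  (tscale V \o tmap eps \1)%VF.

Definition tlunitV V : 'Hom(V, tens (gens one) V) := linfun (pure u).

Lemma tlunit_pure V x (a : V) : tlunit V (pure x a) = (eps x : K) *: a.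
Proof. by rewrite comp_lfunE tmap_pure tscale_pure id_lfunE. Qed.

Lemma tlunitVE V (a : V) : tlunitV V a = pure u a.
Proof. by rewrite lfun_linE //; apply: pure_linearr. Qed.

Lemma tlunitK V : (tlunitV V \o tlunit V = \1)%VF.
Proof.
apply: tens_ext => x a; rewrite comp_lfunE tlunit_pure tlunitVE id_lfunE.
by rewrite -{2}[x]epsK pureZl pureZr.
Qed.

Lemma tlunitVK V : (tlunit V \o tlunitV V = \1)%VF.
Proof.
apply/lfunP => a.
by rewrite comp_lfunE tlunitVE tlunit_pure eps_u scale1r id_lfunE.
Qed.

Lemma tpi_lunit V :
  (tpow_map (tlunit V) N \o tpi _ _ N = tscale (tpow V N) \o tmap teps \1)%VF.
Proof.
apply: (separating_pure (separating_tpure (@separating_id _ (gens one)))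
                        (separating_tpure (@separating_id _ V))) => -[e a] /=.
rewrite !comp_lfunE tmap_pure tscale_pure tpi_pure tpow_map_pure id_lfunE.
rewrite teps_pure -tpureZ; apply: eq_tpure => i; exact: tlunit_pure.
Qed.

(** Since [teps] is invertible, [trel_limg] transports the relations of the unit into K, where
    [trel1] applies. *)
Lemma limg_lunit A :
  (tpow_map (tlunit (gens A)) N @: rels (hntens one A) = rels A)%VS.
Proof.
rewrite -limg_comp tpi_lunit limg_comp.
rewrite -(trel_limg _ _ tepsK tepsVK (comp_lfun1l \1) (comp_lfun1l \1)).
by rewrite lim1g trel1.
Qed.

Fact hnlunit_proof A :
  (tpow_map (tlunit (gens A)) N @: rels (hntens one A) <= rels A)%VS.
Proof. by rewrite limg_lunit. Qed.

Definition hnlunit A : hnhom (hntens one A) A :=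
  @HNHom K N (hntens _ _) _ _ (hnlunit_proof A).

Fact hnlunitV_proof A :
  (tpow_map (tlunitV (gens A)) N @: rels A <= rels (hntens one A))%VS.
Proof.
by rewrite -limg_lunit limgK // -tpow_map_comp tlunitK tpow_map1.
Qed.

Definition hnlunitV A : hnhom A (hntens one A) :=
  @HNHom K N _ (hntens _ _) _ (hnlunitV_proof A).

(** Going through the swap avoids a mirror image of [trel1]. *)
Definition hnrunit A : hnhom (hntens A one) A :=
  hncomp (hnlunit A) (hnswap A one).

Lemma hnrunit_pure A (a : gens A) x :
  hnrunit A (pure a x) = (eps x : K) *: a.
Proof. by rewrite comp_lfunE tswap_pure tlunit_pure. Qed.

Definition hnsimp :=
  (comp_lfunE, id_lfunE, tmap_pure, tassoc_pure, tswap_pure, tlunit_pure).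

Definition hn_tensor_category : @tensor_category (HN_Alg K N) hntens one.
Proof.
refine (@TensorCategory (HN_Alg K N) hntens one hntmap hnassoc hnswap hnlunit
  hnrunit _ _ _ _ _ _ _ _ _ _ _ _ _ _).
- by move=> A B; apply: hnhom_inj; apply: tmap1.
- by move=> *; apply: hnhom_inj; apply: tmap_comp.
- move=> A B D.
  (* The inverse runs A(BD) -> (BD)A -> (DB)A -> D(BA) -> D(AB) -> (AB)D. *)
  exists (hncomp (hnswap D (hntens A B)) (hncomp (hntmap (hnid D) (hnswap B A))
    (hncomp (hnassoc D B A)
      (hncomp (hntmap (hnswap B D) (hnid A)) (hnswap A (hntens B D)))))).
  split; apply: hnhom_inj.
    by apply: tens_ext3 => a b d; rewrite !hnsimp.
  by apply: tens_ext3r => a b d; rewrite !hnsimp.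
- by move=> A B; exists (hnswap B A); split; apply: hnswapK.
- move=> A; exists (hnlunitV A); split; apply: hnhom_inj; first exact: tlunitK.
  exact: tlunitVK.
- move=> A; exists (hncomp (hnswap one A) (hnlunitV A)).
  have swK V W : (tswap W V \o tswap V W = \1)%VF.
    by apply: tens_ext => a b; rewrite !hnsimp.
  split; apply: hnhom_inj => /=.
    by rewrite comp_lfunA -[X in (X \o _)%VF]comp_lfunA tlunitK comp_lfun1r swK.
  by rewrite comp_lfunA -[X in (X \o _)%VF]comp_lfunA swK comp_lfun1r tlunitVK.
- move=> *; apply: hnhom_inj; apply: tens_ext3 => a b d /=.
  by rewrite !hnsimp.
- move=> *; apply: hnhom_inj; apply: tens_ext => a b /=.
  by rewrite !hnsimp.
- move=> *; apply: hnhom_inj; apply: tens_ext => a b /=.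
  by rewrite !hnsimp linearZ.
- move=> *; apply: hnhom_inj; apply: tens_ext => a b /=.
  by rewrite !hnsimp linearZ.
- move=> *; apply: hnhom_inj; apply: tens_ext4 => a b d e /=.
  by rewrite !hnsimp.
- move=> A B; apply: hnhom_inj; apply: tens_ext3 => a x b /=.
  by rewrite !hnsimp pureZl pureZr.
- move=> *; apply: hnhom_inj; apply: tens_ext3 => a b d /=.
  by rewrite !hnsimp.
- by move=> A B; apply: hnswapK.
Defined.

End TensorRel.

(** * The operations behind the circle and bullet products *)

Section Instances.
Variable K : fieldType.
Implicit Types V W : vectType K.

Lemma tensvS V V' W W' (f : 'Hom(V, V')) (g : 'Hom(W, W')) U U1 U' U1' :
  (f @: U <= U1)%VS -> (g @: U' <= U1')%VS ->
  (tmap f g @: tensv U U' <= tensv U1 U1')%VS.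
Proof.
move=> /subvP fU /subvP gU'; rewrite limg_span; apply/span_subvP.
move=> _ /mapP[_ /allpairsP[[a b] /= [aU bU' ->]] ->]; rewrite tmap_pure.
by rewrite memv_tensv ?fU ?gU' ?memv_img // vbasis_mem.
Qed.

(** Reduces associativity to triple pure tensors; used for the bullet product and for each summand
    of the circle product. *)
Lemma tensv_assoc_sub V V' V'' (U : {vspace V}) (U' : {vspace V'})
    (U'' : {vspace V''}) (S : {vspace tens V (tens V' V'')}) :
  (forall a b c, a \in U -> b \in U' -> c \in U'' -> pure a (pure b c) \in S) ->
  (tassoc V V' V'' @: tensv (tensv U U') U'' <= S)%VS.
Proof.
move=> sub; rewrite limg_span; apply/span_subvP.
move=> _ /mapP[_ /allpairsP[[w c] /= [/vbasis_mem wU /vbasis_mem cU ->]] ->].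
(* Here [w] need not be a pure tensor; for fixed [c] the expression is linear in [w], so the inner
   span can be tested on its generators. *)
rewrite -(lfun_linE (pure_linearl _)) -comp_lfunE.
suff /subvP/(_ _ (memv_img _ wU)) :
  ((tassoc V V' V'' \o linfun (fun w => pure w c : tens (tens V V') V''))
     @: tensv U U' <= S)%VS by [].
rewrite limg_span; apply/span_subvP.
move=> _ /mapP[_ /allpairsP[[a b] /= [/vbasis_mem aU /vbasis_mem bU ->]] ->].
rewrite comp_lfunE lfun_linE ?tassoc_pure ?sub //; exact: pure_linearl.
Qed.

Lemma tensvC V W (U : {vspace V}) (U' : {vspace W}) :
  (tswap V W @: tensv U U' <= tensv U' U)%VS.
Proof.
rewrite limg_span; apply/span_subvP.
move=> _ /mapP[_ /allpairsP[[a b] /= [/vbasis_mem aU /vbasis_mem bU ->]] ->].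
by rewrite tswap_pure memv_tensv.
Qed.

Lemma tensv_addl V W (U U1 : {vspace V}) (U' : {vspace W}) :
  (tensv (U + U1) U' <= tensv U U' + tensv U1 U')%VS.
Proof.
apply: tensv_subP => w b /memv_addP[a aU [a1 a1U ->]] bU.
rewrite -[a]scale1r pure_linearl scale1r.
by apply: memv_add; apply: memv_tensv.
Qed.

Lemma limg_tscale V (U : {vspace V}) :
  (tscale V @: tensv fullv U = U)%VS.
Proof.
apply/eqP; rewrite eqEsubv; apply/andP; split.
  rewrite limg_span; apply/span_subvP.
  move=> _ /mapP[_ /allpairsP[[k a] /= [_ /vbasis_mem aU ->]] ->].
  by rewrite tscale_pure rpredZ.
apply/subvP => a aU; apply/memv_imgP; exists (pure (1 : K^o) a).
  by rewrite memv_tensv ?memvf.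
by rewrite tscale_pure scale1r.
Qed.

Definition tensv_rel : tensor_rel K.
Proof.
refine (@TensorRel K (@tensv K) tensvS _ tensvC) => V V' V'' U U' U''.
by apply: tensv_assoc_sub => a b c aU bU cU; rewrite !memv_tensv.
Defined.

(** For associativity, both bracketings amount to the sum of the three subspaces with one of [U],
    [U'], [U''] in its own slot and full spaces elsewhere. *)
Definition tensv_add_rel : tensor_rel K.
Proof.
refine (@TensorRel K (@tensv_add K) _ _ _).
- move=> V V' W W' f g U U1 U' U1' fU gU; rewrite limgD.
  by apply: addvS; apply: tensvS; rewrite ?subvf.
- move=> V V' V'' U U' U''; rewrite limgD subv_add; apply/andP; split.
    apply: subv_trans (limgS _ (tensv_addl _ _ _)) _; rewrite limgD subv_add.
    apply/andP; split; apply: tensv_assoc_sub => a b c aU bU cU.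
      by rewrite (subvP (addvSl _ _)) // memv_tensv ?memvf.
    rewrite (subvP (addvSr _ _)) // memv_tensv ?memvf //.
    by rewrite (subvP (addvSl _ _)) // memv_tensv ?memvf.
  (* In the summand of [U''], the full space of V (x) V' is split as a tensor product to fit
     [tensv_assoc_sub]. *)
  rewrite -tensv_fullv; apply: tensv_assoc_sub => a b c aU bU cU.
  rewrite (subvP (addvSr _ _)) // memv_tensv ?memvf //.
  by rewrite (subvP (addvSr _ _)) // memv_tensv ?memvf.
move=> V W U U'; rewrite limgD addvC.
by apply: addvS; apply: tensvC.
Defined.

End Instances.

(** * The two tensor structures *)

Theorem theorem1 (K : fieldType) (N : nat) (hN : (2 <= N)%N) :
  (exists M : @tensor_category (HN_Alg K N) (@hncirc K N) (hnpoly K N),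
     (forall (A A' B B' : hnalg K N) (f : hnhom A A') (g : hnhom B B'),
        hnlin (tens_hom M f g) = tmap (hnlin f) (hnlin g))
     /\ (forall (A B C : hnalg K N) (a : gens A) (b : gens B) (c : gens C),
           hnlin (assoc M A B C) (pure (pure a b) c) = pure a (pure b c))
     /\ (forall (A B : hnalg K N) (a : gens A) (b : gens B),
           hnlin (swap M A B) (pure a b) = pure b a)
     /\ (forall (A : hnalg K N) (k : K^o) (a : gens A),
           hnlin (lunit M A) (pure k a) = (k : K) *: a)
     /\ (forall (A : hnalg K N) (k : K^o) (a : gens A),
           hnlin (runit M A) (pure a k) = (k : K) *: a))
  /\
  (exists M : @tensor_category (HN_Alg K N) (@hnbullet K N) (hnwedge K N),
     (forall (A A' B B' : hnalg K N) (f : hnhom A A') (g : hnhom B B'),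
        hnlin (tens_hom M f g) = tmap (hnlin f) (hnlin g))
     /\ (forall (A B C : hnalg K N) (a : gens A) (b : gens B) (c : gens C),
           hnlin (assoc M A B C) (pure (pure a b) c) = pure a (pure b c))
     /\ (forall (A B : hnalg K N) (a : gens A) (b : gens B),
           hnlin (swap M A B) (pure a b) = pure b a)
     /\ (forall (A : hnalg K N) (phi : 'Hom(K^o, K^o)) (a : gens A),
           hnlin (lunit M A) (pure (phi : dual K^o) a) = (phi 1 : K) *: a)
     /\ (forall (A : hnalg K N) (phi : 'Hom(K^o, K^o)) (a : gens A),
           hnlin (runit M A) (pure a (phi : dual K^o)) = (phi 1 : K) *: a)).
Proof.
split.
  have eps_u : (\1%VF : 'End(K^o)) 1 = 1 by rewrite id_lfunE.
  have epsK (k : K^o) : ((\1%VF : 'End(K^o)) k : K) *: (1 : K^o) = k.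
    by rewrite id_lfunE -[_ *: _]/(k * 1) mulr1.
  (* The relations of K[t] are zero, so the first summand of [tensv_add] vanishes and the second is
     K (x) U. *)
  have unit0 (V : vectType K) (U : {vspace V}) :
      (tscale V @: tensv_add ((teps (one := hnpoly K N) \1) @: 0) U = U)%VS.
    rewrite limg0 limgD limg_tscale; apply: addv_idPr.
    suff -> : tensv 0 fullv = 0%VS :> {vspace tens K^o V}.
      by rewrite limg0 sub0v.
    apply/eqP; rewrite -subv0; apply: tensv_subP => a b; rewrite !memv0.
    by move=> /eqP-> _; rewrite -(scale0r (0 : K^o)) pureZl scale0r.
  exists (hn_tensor_category (one := hnpoly K N) (T := tensv_add_rel K)
            (eps := \1%VF) eps_u epsK unit0).
  split=> [//|]; split=> [A B C a b c|]; first exact: tassoc_pure.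
  split=> [A B a b|]; first exact: tswap_pure.
  split=> [A k a|A k a]; first by rewrite tlunit_pure id_lfunE.
  by rewrite hnrunit_pure id_lfunE.
(* The unit is now generated by the dual of K, with basis the identity d; the coordinate of a form
   is its value at 1. *)
pose ev : 'Hom(dual K^o, K^o) :=
  linfun (fun phi : dual K^o => (phi : 'Hom(K^o, K^o)) 1).
have evE (phi : dual K^o) : ev phi = (phi : 'Hom(K^o, K^o)) 1.
  by rewrite lfun_linE // => k f g; rewrite add_lfunE scale_lfunE.
have ev_u : ev (\1%VF : 'End(K^o)) = 1 by rewrite evE id_lfunE.
have evK (phi : dual K^o) : (ev phi : K) *: (\1%VF : dual K^o) = phi.
  apply/lfunP => k; rewrite scale_lfunE id_lfunE evE.
  rewrite -[in RHS](mulr1 k) -[k * 1]/(k *: (1 : K^o)) linearZ; exact: mulrC.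
(* Every form vanishes on the zero space of relations of K[t]. *)
have rels1 : rels (hnwedge K N) = fullv.
  apply/eqP; rewrite eqEsubv subvf; apply/subvP => w _.
  rewrite -memv_preim; apply/memv_annihilator => x.
  by rewrite memv0 => /eqP->; rewrite linear0.
have unit1 (V : vectType K) (U : {vspace V}) :
    (tscale V @: tensv ((teps (one := hnwedge K N) ev) @: rels (hnwedge K N)) U
       = U)%VS.
  rewrite rels1 -[RHS]limg_tscale; congr (_ @: tensv _ _)%VS.
  (* [teps] is onto, having [tepsV] as a right inverse, so the image of the relations is all of
     K. *)
  apply/eqP; rewrite eqEsubv subvf -[X in (X <= _)%VS]lim1g.
  rewrite -(tepsVK (one := hnwedge K N) (eps := ev) ev_u) limg_comp.
  by rewrite limgS ?subvf.
exists (hn_tensor_category (one := hnwedge K N) (T := tensv_rel K)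
          (eps := ev) ev_u evK unit1).
split=> [//|]; split=> [A B C a b c|]; first exact: tassoc_pure.
split=> [A B a b|]; first exact: tswap_pure.
split=> [A k a|A k a]; first by rewrite tlunit_pure evE.
by rewrite hnrunit_pure evE.
Qed.
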